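(* Let $G$ be a finite group of one-to-one transformations of $\mathcal{X}$ onto itself such that for each $g\in G$ there is a nonsingular matrix $\mathbf{Q}_g$ with $\mathbf{f}(g(\mathbf{x}))=\mathbf{Q}_g\mathbf{f}(\mathbf{x})$ for all $\mathbf{x}\in\mathcal{X}$, and let $\tilde g$, $g\in G$, be the associated parameter transformations (described in the context). Let $\boldsymbol\beta\in\mathcal{B}$. (i) If $\tilde g(\boldsymbol\beta)=\boldsymbol\beta$ for all $g\in G$, then there exists a locally $D$-optimal design $\xi^*$ at $\boldsymbol\beta$ which is invariant with respect to $G$. (ii) If additionally the standardized measure $\nu$ on $\mathcal{X}$ is invariant with respect to $G$, i.e. $\nu^g=\nu$ for all $g\in G$, then there exists a locally $IMSE$-optimal design $\xi^*$ at $\boldsymbol\beta$ with respect to $\nu$ which is invariant with respect to $G$.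
   Context: $\mathbf{f}:\mathcal{X}\to\mathbb{R}^p$ is a vector of regression functions, linearly independent on the experimental region $\mathcal{X}$; $\mathcal{B}\subseteq\mathbb{R}^p$ is the parameter region; $\lambda$ (the intensity function) is a positive real function defined on a set of reals containing all values $\mathbf{f}(\mathbf{x})^{\mathsf T}\boldsymbol\beta$, $\mathbf{x}\in\mathcal{X}$, $\boldsymbol\beta\in\mathcal{B}$. Each parameter transformation $\tilde g$ maps $\mathcal{B}$ onto $\mathcal{B}$ and is of one of two kinds: either (linear case) $\tilde g(\boldsymbol\beta)=\mathbf{Q}_g^{-\mathsf T}\boldsymbol\beta$ for all $g\in G$; or (extended case, only for the gamma model with inverse link, where $\lambda(z)=\kappa/z^2$ for $z>0$ with fixed $\kappa>0$ and $\mathbf{f}(\mathbf{x})^{\mathsf T}\boldsymbol\beta>0$ on $\mathcal{X}$ for all $\boldsymbol\beta\in\mathcal{B}$) $\tilde g(\boldsymbol\beta)=\tilde c_g(\boldsymbol\beta)\mathbf{Q}_g^{-\mathsf T}\boldsymbol\beta$ with functions $\tilde c_g:\mathcal{B}\to(0,\infty)$ such that the $\tilde g$ share the group structure of $G$, i.e. the transformation associated with $g\circ h$ is $\tilde g\circ\tilde h$. Here $\mathbf{Q}^{-\mathsf T}$ denotes the inverse of the transpose of $\mathbf{Q}$. A design $\xi$ on $\mathcal{X}$ is given by finitely many distinct support points $\mathbf{x}_i\in\mathcal{X}$ and weights $w_i>0$, $\sum_iw_i=1$; $\xi^g$ has support points $g(\mathbf{x}_i)$ and weights $w_i$; a standardized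 measure is one with $\nu(\mathcal{X})=1$, and $\nu^g$ is the image of $\nu$ under $g$; $\xi$ is invariant with respect to $G$ if $\xi^g=\xi$ for all $g\in G$. Information matrix: $\mathbf{M}(\xi;\boldsymbol\beta)=\sum_iw_i\,\lambda(\mathbf{f}(\mathbf{x}_i)^{\mathsf T}\boldsymbol\beta)\,\mathbf{f}(\mathbf{x}_i)\mathbf{f}(\mathbf{x}_i)^{\mathsf T}$; and $\mathbf{V}(\boldsymbol\beta;\nu)=\int\lambda(\mathbf{f}(\mathbf{x})^{\mathsf T}\boldsymbol\beta)^2\,\mathbf{f}(\mathbf{x})\mathbf{f}(\mathbf{x})^{\mathsf T}\,\nu(\mathrm{d}\mathbf{x})$. A design is locally $D$-optimal at $\boldsymbol\beta$ if it minimizes $\det(\mathbf{M}(\xi;\boldsymbol\beta)^{-1})$ (set to $\infty$ for singular $\mathbf{M}(\xi;\boldsymbol\beta)$) over the designs on $\mathcal{X}$, and locally $IMSE$-optimal at $\boldsymbol\beta$ with respect to $\nu$ if it minimizes $\mathrm{trace}(\mathbf{V}(\boldsymbol\beta;\nu)\mathbf{M}(\xi;\boldsymbol\beta)^{-1})$ (defined for nonsingular $\mathbf{M}(\xi;\boldsymbol\beta)$).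
   Formalization: Existence of some locally D-optimal (resp. IMSE-optimal) design is assumed, since without compactness none need exist (e.g. X=(0,1), f=(1,x), λ=1, G trivial); in (ii) each g is assumed measurable and the integrand of V ν-integrable so that ν^g and V are defined. *)

(* Defs.v *)
From HB Require Import structures.
From mathcomp Require Import all_boot all_order all_algebra.
From mathcomp Require Import all_classical all_reals all_analysis.

Set Implicit Arguments.
Unset Strict Implicit.
Unset Printing Implicit Defensive.

Import Order.TTheory GRing.Theory Num.Theory.

Local Open Scope classical_set_scope.
Local Open Scope ring_scope.

Definition transformation_group (X : Type) (G : set (X -> X)) : Prop :=
  [/\ forall g, G g -> bijective g,
      G id,
      forall g h, G g -> G h -> G (g \o h) &
      forall g, G g -> exists h, [/\ G h, cancel g h & cancel h g]].

Definition regression_independent (R : realType) (X : Type) (p : nat)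
    (f : X -> 'cV[R]_p) : Prop :=
  forall a : 'cV[R]_p, (forall x, (a^T *m f x) 0 0 = 0) -> a = 0.

Definition linpred (R : realType) (X : Type) (p : nat) (f : X -> 'cV[R]_p)
    (x : X) (b : 'cV[R]_p) : R := ((f x)^T *m b) 0 0.

(* A design is encoded by its weight function [w], extended by zero outside
   the support: the support points are the [x] with [w x != 0].  Thus two
   designs agree (up to reordering of the support) iff their weight functions
   are equal. *)
Definition is_design (R : realType) (X : choiceType) (w : X -> R) : Prop :=
  [/\ forall x, 0 <= w x,
      finite_set [set x | w x != 0] &
      \sum_(x \in [set: X]) w x = 1].

Definition design_image (R : realType) (X : choiceType) (g : X -> X)
    (w : X -> R) : X -> R :=
  fun y => \sum_(x \in [set x | g x = y]) w x.

Lemma design_imageE (R : realType) (X : choiceType) (g : X -> X) (w : X -> R)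
    (x : X) : injective g -> design_image g w (g x) = w x.
Proof.
move=> gI; rewrite /design_image.
rewrite (_ : [set x0 | g x0 = g x] = [set x]) ?fsbig_set1//.
by apply/seteqP; split=> [y /= /gI|y ->].
Qed.

Definition design_invariant (R : realType) (X : choiceType)
    (G : set (X -> X)) (w : X -> R) : Prop :=
  forall g, G g -> design_image g w = w.

Definition information (R : realType) (X : choiceType) (p : nat)
    (f : X -> 'cV[R]_p) (lam : R -> R) (w : X -> R) (b : 'cV[R]_p) : 'M[R]_p :=
  \sum_(x \in [set: X]) (w x * lam (linpred f x b)) *: (f x *m (f x)^T).

Definition D_criterion (R : realType) (X : choiceType) (p : nat)
    (f : X -> 'cV[R]_p) (lam : R -> R) (b : 'cV[R]_p) (w : X -> R) : \bar R :=
  let M := information f lam w b in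
  if M \in unitmx then (\det (invmx M))%:E else +oo%E.

Definition locally_D_optimal (R : realType) (X : choiceType) (p : nat)
    (f : X -> 'cV[R]_p) (lam : R -> R) (b : 'cV[R]_p) (w : X -> R) : Prop :=
  is_design w /\
  forall v, is_design v ->
    (D_criterion f lam b w <= D_criterion f lam b v)%E.

Definition V_integrand (R : realType) (X : Type) (p : nat)
    (f : X -> 'cV[R]_p) (lam : R -> R) (b : 'cV[R]_p) (x : X) : 'M[R]_p :=
  (lam (linpred f x b) ^+ 2) *: (f x *m (f x)^T).

(* Without this condition the matrix V(b; nu) is not defined. *)
Definition V_integrable (R : realType) (d : measure_display)
    (X : measurableType d) (p : nat) (f : X -> 'cV[R]_p) (lam : R -> R)
    (b : 'cV[R]_p) (nu : probability X R) : Prop :=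
  forall i j, nu.-integrable [set: X] (EFin \o fun x => V_integrand f lam b x i j).

Definition V_matrix (R : realType) (d : measure_display)
    (X : measurableType d) (p : nat) (f : X -> 'cV[R]_p) (lam : R -> R)
    (b : 'cV[R]_p) (nu : probability X R) : 'M[R]_p :=
  \matrix_(i, j) Rintegral nu [set: X] (fun x => V_integrand f lam b x i j).

Definition IMSE (R : realType) (d : measure_display)
    (X : measurableType d) (p : nat) (f : X -> 'cV[R]_p) (lam : R -> R)
    (b : 'cV[R]_p) (nu : probability X R) (w : X -> R) : R :=
  \tr (V_matrix f lam b nu *m invmx (information f lam w b)).

Definition locally_IMSE_optimal (R : realType) (d : measure_display)
    (X : measurableType d) (p : nat) (f : X -> 'cV[R]_p) (lam : R -> R)
    (b : 'cV[R]_p) (nu : probability X R) (w : X -> R) : Prop :=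
  [/\ is_design w,
      information f lam w b \in unitmx &
      forall v, is_design v -> information f lam v b \in unitmx ->
        IMSE f lam b nu w <= IMSE f lam b nu v].

Definition measure_invariant (R : realType) (d : measure_display)
    (X : measurableType d) (G : set (X -> X)) (nu : probability X R) : Prop :=
  forall g, G g -> forall A, measurable A -> pushforward nu g A = nu A.

Definition linear_transformations (R : realType) (X : Type) (p : nat)
    (B : set 'cV[R]_p) (G : set (X -> X)) (Q : (X -> X) -> 'M[R]_p)
    (gt : (X -> X) -> 'cV[R]_p -> 'cV[R]_p) : Prop :=
  forall g, G g -> forall b, B b -> gt g b = invmx ((Q g)^T) *m b.

(* Gamma model with inverse link; only the values of the intensity on
   positive reals are prescribed. *)
Definition gamma_inverse_link (R : realType) (X : Type) (p : nat)
    (f : X -> 'cV[R]_p) (lam : R -> R) (B : set 'cV[R]_p) : Prop :=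
  (exists2 kappa : R, 0 < kappa & forall z, 0 < z -> lam z = kappa / z ^+ 2)
  /\ (forall x b, B b -> 0 < linpred f x b).

Definition extended_transformations (R : realType) (X : Type) (p : nat)
    (B : set 'cV[R]_p) (G : set (X -> X)) (Q : (X -> X) -> 'M[R]_p)
    (gt : (X -> X) -> 'cV[R]_p -> 'cV[R]_p) : Prop :=
  (exists c : (X -> X) -> 'cV[R]_p -> R,
     forall g, G g -> forall b, B b ->
       0 < c g b /\ gt g b = c g b *: (invmx ((Q g)^T) *m b))
  /\ (forall g h, G g -> G h -> forall b, B b ->
       gt (g \o h) b = gt g (gt h b)).

(* Main.v *)
(* Given an optimal design w, average its images under G.  The fixed point
   condition makes x |-> f(x)^T b constant on orbits, so the information matrix
   M of w is transformed into Q_g^-1 M Q_g^-T, and the averaged matrix S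
   satisfies S = Q_g S Q_g^T.  Hence tr (W S) = tr (W M) for every W with
   Q_g^T W Q_g = W.  With W = S^-1 this gives tr (S^-1 M) = p, and
   det M <= det S follows from Hadamard's inequality and AM-GM.  With
   W = S^-1 V S^-1 it gives tr (V S^-1) <= tr (V M^-1), because
   tr (V D M D) >= 0 for D = M^-1 - S^-1. *)
Require Import Defs.
From HB Require Import structures.
From mathcomp Require Import all_boot all_order all_algebra.
From mathcomp Require Import all_classical all_reals all_analysis.
From mathcomp Require Import finmap ring lra.

Set Implicit Arguments.
Unset Strict Implicit.
Unset Printing Implicit Defensive.

Import Order.TTheory GRing.Theory Num.Theory.

Local Open Scope classical_set_scope.
Local Open Scope ring_scope.

(** * Positive definite matrices: Cholesky factor, Hadamard's inequality, comparison of determinants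
    and traces *)

Definition posdef (R : numDomainType) (n : nat) (A : 'M[R]_n) : Prop :=
  A^T = A /\ forall u : 'cV[R]_n, u != 0 -> 0 < (u^T *m A *m u) 0 0.

(** Minimising the block form over its first coordinate, with [u] fixed, leaves the form of the
    Schur complement at [u]. *)
Lemma posdef_schur (R : realFieldType) (n : nat) (a : R) (v : 'cV[R]_n)
    (C : 'M[R]_n) : 0 < a -> posdef (block_mx a%:M v^T v C) ->
  posdef (C - a^-1 *: (v *m v^T)).
Proof.
move=> a0 [symA posA]; split.
  move: symA; rewrite tr_block_mx => /eq_block_mx[_ _ _ CT].
  by rewrite linearB linearZ /= trmx_mul trmxK CT.
move=> u u0; set s := (v^T *m u) 0 0.
have vu : v^T *m u = s%:M by rewrite [LHS]mx11_scalar.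
have uv : u^T *m v = s%:M.
  by rewrite -[RHS]tr_scalar_mx -vu trmx_mul trmxK.
(* The first coordinate [- s / a] is the minimiser. *)
have /posA : col_mx (- (a^-1 * s))%:M u != 0 :> 'cV[R]_(1 + n).
  by apply: contra_neq u0; rewrite -[0]col_mx0 => /eq_col_mx[].
rewrite tr_col_mx mul_row_block mul_row_col tr_scalar_mx.
rewrite uv mulmxDl [in X in _ + X]mulmxDl -(mulmxA _ v^T) vu.
rewrite mulmxBr mulmxBl -scalemxAr -scalemxAl (mulmxA u^T v) uv.
rewrite -(mulmxA _ v^T) vu.
rewrite !mul_mx_scalar !scale_scalar_mx.
move: (u^T *m C *m u) => q; rewrite !mxE eqxx !mulr1n.
suff -> : - (a^-1 * s) * (a * - (a^-1 * s)) + - (a^-1 * s) * s +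
  (s * - (a^-1 * s) + q 0 0) = q 0 0 + - (a^-1 * (s * s)) by [].
by field; rewrite gt_eqF.
Qed.

(** Induction on the size: the first row and column are eliminated, and the Schur complement is
    factored by the induction hypothesis. *)
Lemma cholesky (R : rcfType) (n : nat) (A : 'M[R]_n) : posdef A ->
  exists K : 'M[R]_n, [/\ is_trig_mx K, K \in unitmx & A = K *m K^T].
Proof.
elim: n A => [|n IHn] A; first exists 1%:M.
  rewrite unitmx1 [A]flatmx0 [RHS]flatmx0.
  by split=> //; apply/is_trig_mxP => -[].
move=> pdA; have [symA posA] := pdA.
pose a := A 0 0; pose v : 'cV[R]_n := @dlsubmx R 1 n 1 n A.
pose C : 'M[R]_n := @drsubmx R 1 n 1 n A.
have a0 : 0 < a.
  have /posA : delta_mx 0 0 != 0 :> 'cV[R]_(n.+1).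
    by apply/eqP => /matrixP /(_ 0 0) /eqP; rewrite !mxE eqxx oner_eq0.
  by rewrite trmx_delta -rowE -colE !mxE.
have AE : A = block_mx a%:M v^T v C :> 'M[R]_(1 + n).
  rewrite -[LHS](@submxK _ 1 n 1 n); congr block_mx.
    by rewrite [LHS]mx11_scalar !mxE; congr (A _ _)%:M; apply: val_inj.
  by rewrite /v trmx_dlsub symA.
have [|K [Kt Ku KE]] := IHn (C - a^-1 *: (v *m v^T)).
  by apply: posdef_schur => //; rewrite -AE.
pose L : 'M[R]_(1 + n) := block_mx (Num.sqrt a)%:M 0 ((Num.sqrt a)^-1 *: v) K.
have sa0 : Num.sqrt a != 0 by rewrite gt_eqF // sqrtr_gt0.
exists L; split.
- rewrite (@is_trig_block_mx _ 1 n 1 n) // eqxx Kt andbT.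
  by apply/is_trig_mxP => i j; rewrite !ord1.
- by rewrite unitmxE (@det_lblock _ 1) det_scalar1 unitrM unitfE sa0 -unitmxE.
rewrite AE /L (@tr_block_mx _ 1 n 1 n) (@mulmx_block _ 1 n 1 n 1 n).
rewrite tr_scalar_mx trmx0 linearZ /= !mulmx0 !mul0mx !addr0.
apply: (f_equal4 (@block_mx R 1 n 1 n)).
- by rewrite -scalar_mxM -expr2 sqr_sqrtr // ltW.
- by rewrite mul_scalar_mx scalerA divff // scale1r.
- by rewrite mul_mx_scalar scalerA divff // scale1r.
rewrite -KE -scalemxAl -scalemxAr scalerA -invfM -expr2 sqr_sqrtr ?ltW //.
by rewrite addrC subrK.
Qed.

(** With A = K K^T and K triangular, det A is the product of the K_ii^2, while A_ii is the squared
    norm of row i of K and so is at least K_ii^2. *)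
Lemma hadamard_posdef (R : rcfType) (n : nat) (A : 'M[R]_n) :
  posdef A -> \det A <= \prod_i A i i.
Proof.
move=> /cholesky[K [Kt _ ->]]; rewrite det_mulmx det_tr det_trig // -big_split /=.
apply: ler_prod => i _; rewrite -expr2 sqr_ge0 /=.
rewrite mxE (bigD1 i) //= mxE -expr2 lerDl.
by apply: sumr_ge0 => j _; rewrite mxE -expr2 sqr_ge0.
Qed.

Lemma posdef_diag_gt0 (R : numDomainType) (n : nat) (A : 'M[R]_n) (i : 'I_n) :
  posdef A -> 0 < A i i.
Proof.
move=> [_ posA]; have /posA : delta_mx i 0 != 0 :> 'cV[R]_n.
  by apply/eqP => /matrixP /(_ i 0) /eqP; rewrite !mxE !eqxx oner_eq0.
by rewrite trmx_delta -rowE -colE !mxE.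
Qed.

(** Hadamard bounds the determinant by the product of the diagonal, and AM-GM bounds that by (tr A /
    n)^n = 1. *)
Lemma posdef_det_le1 (R : rcfType) (n : nat) (A : 'M[R]_n) :
  posdef A -> \tr A = n%:R -> \det A <= 1.
Proof.
move=> pdA trA; apply: (le_trans (hadamard_posdef pdA)).
have [] := @leif_AGM R 'I_n predT (fun i => A i i) _.
  by move=> i _; rewrite ltW // posdef_diag_gt0.
move=> + _; rewrite -/(\tr A) trA card_ord => /le_trans; apply.
(* Size 0 is separate because n / n is not 1 there; the exponent 0 still gives 1. *)
case: n {A pdA trA} => [|n]; first by rewrite expr0.
by rewrite divff ?expr1n // pnatr_eq0.
Qed.

Lemma posdef_cong (R : numDomainType) (n : nat) (A P : 'M[R]_n) :
  posdef A -> (forall u : 'cV_n, P^T *m u = 0 -> u = 0) -> posdef (P *m A *m P^T).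
Proof.
move=> [symA posA] Pinj; split; first by rewrite !trmx_mul trmxK symA mulmxA.
move=> u u0; have /posA : P^T *m u != 0 by apply: contra_neq u0; apply: Pinj.
by rewrite trmx_mul trmxK !mulmxA.
Qed.

Lemma posdef_det_gt0 (R : rcfType) (n : nat) (A : 'M[R]_n) :
  posdef A -> 0 < \det A.
Proof.
move=> /cholesky[K [_ Ku ->]]; rewrite det_mulmx det_tr -expr2.
rewrite lt_def sqr_ge0 andbT.
by rewrite expf_neq0 // -unitfE -unitmxE.
Qed.

Lemma posdef_unitmx (R : rcfType) (n : nat) (A : 'M[R]_n) :
  posdef A -> A \in unitmx.
Proof. by move=> /posdef_det_gt0; rewrite unitmxE unitfE; apply: lt0r_neq0. Qed.

(* With S = K K^T, the matrix K^-1 A K^-T is positive definite of trace n. *)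
Lemma det_le_of_trace (R : rcfType) (n : nat) (S A : 'M[R]_n) :
  posdef S -> posdef A -> \tr (invmx S *m A) = n%:R -> \det A <= \det S.
Proof.
move=> /cholesky[K [_ Ku SE]] pdA trSA.
have pdB : posdef (invmx K *m A *m (invmx K)^T).
  apply: posdef_cong => // u; rewrite trmx_inv => /(congr1 (mulmx K^T)).
  by rewrite mulKVmx ?unitmx_tr // mulmx0.
have invS : invmx S = (invmx K)^T *m invmx K.
  have Su : S \in unitmx by rewrite SE unitmx_mul unitmx_tr Ku.
  apply: (can_inj (mulKmx Su)); rewrite mulmxV // SE trmx_inv.
  by rewrite -mulmxA mulKVmx ?unitmx_tr // mulmxV.
have := posdef_det_le1 pdB.
(* By cyclicity tr (K^-1 A K^-T) = tr (S^-1 A); the determinant of the same matrix is det A / (det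
   K)^2 = det A / det S. *)
rewrite mxtrace_mulC mulmxA -invS => /(_ trSA).
rewrite SE !det_mulmx !det_tr det_inv mulrAC -expr2 exprVn.
rewrite -[X in _ -> _ <= X]expr2.
rewrite mulrC ler_pdivrMr ?mul1r // lt_def sqr_ge0 andbT.
by rewrite expf_neq0 // -unitfE -unitmxE.
Qed.

(** With A = K K^T the trace is the sum of c^T V c over the columns c of D K. *)
Lemma trace_mul_psd_ge0 (R : rcfType) (n : nat) (V A D : 'M[R]_n) :
  (forall u : 'cV_n, 0 <= (u^T *m V *m u) 0 0) -> posdef A ->
  0 <= \tr (V *m (D *m A *m D^T)).
Proof.
move=> psdV /cholesky[K [_ _ ->]].
have -> : D *m (K *m K^T) *m D^T = (D *m K) *m (D *m K)^T.
  by rewrite trmx_mul !mulmxA.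
rewrite mulmxA mxtrace_mulC; apply: sumr_ge0 => i _.
have := psdV (col i (D *m K)).
rewrite tr_col -row_mul colE mulmxA -row_mul -colE !mulmxA.
by rewrite [col _ _ _ _]mxE [row _ _ _ _]mxE.
Qed.

(** For D = A^-1 - S^-1, the product D A D expands to A^-1 - 2 S^-1 + S^-1 A S^-1. The trace
    hypothesis makes the last term cancel one copy of tr (V S^-1). *)
Lemma trace_inv_le (R : rcfType) (n : nat) (V S A : 'M[R]_n) :
  (forall u : 'cV_n, 0 <= (u^T *m V *m u) 0 0) -> posdef S -> posdef A ->
  \tr (invmx S *m V *m invmx S *m A) = \tr (V *m invmx S) ->
  \tr (V *m invmx S) <= \tr (V *m invmx A).
Proof.
move=> psdV pdS pdA trE; have := trace_mul_psd_ge0 (invmx A - invmx S) psdV pdA.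
have Au := posdef_unitmx pdA; have [symS _] := pdS; have [symA _] := pdA.
rewrite linearB /= !trmx_inv symA symS mulmxBl mulVmx // mulmxBl mul1mx.
rewrite (mulmxBr (invmx S *m A)) mulmxK //.
rewrite !mulmxBr !linearB /=.
have -> : \tr (V *m (invmx S *m A *m invmx S)) = \tr (V *m invmx S).
  by rewrite -trE; do 3!rewrite [LHS]mxtrace_mulC -!mulmxA.
lra.
Qed.

(** * Information matrices of finitely supported weights *)

Lemma fsbig_finite_support (V : nmodType) (X : choiceType) (S : set X)
    (F : X -> V) : finite_set S -> (forall x, ~ S x -> F x = 0) ->
  \sum_(x \in [set: X]) F x = \sum_(x <- fset_set S) F x.
Proof.
move=> Sfin F0; apply: fsbigTE => x; rewrite in_fset_set // => /negP xS.
by apply: F0 => Sx; apply: xS; apply/mem_set.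
Qed.

(** [S] may be larger than the support, so that several weight functions can be summed over one
    index set. *)
Lemma information_finite_support (R : realType) (X : choiceType) (p : nat)
    (f : X -> 'cV[R]_p) (lam : R -> R) (w : X -> R) (b : 'cV[R]_p)
    (S : set X) : finite_set S -> (forall x, ~ S x -> w x = 0) ->
  information f lam w b =
  \sum_(x <- fset_set S) (w x * lam (linpred f x b)) *: (f x *m (f x)^T).
Proof.
move=> Sfin w0; apply: fsbig_finite_support => // x Sx.
by rewrite w0 // mul0r scale0r.
Qed.

Lemma information_finE (R : realType) (X : choiceType) (p : nat)
    (f : X -> 'cV[R]_p) (lam : R -> R) (w : X -> R) (b : 'cV[R]_p) :
  finite_set [set x | w x != 0] ->
  information f lam w b =
  \sum_(x <- fset_set [set x | w x != 0])
    (w x * lam (linpred f x b)) *: (f x *m (f x)^T).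
Proof.
move=> fin; apply: information_finite_support => // x /= /negP.
by rewrite negbK => /eqP.
Qed.

Lemma finite_support_comp (R : realType) (X : choiceType) (g : X -> X)
    (w : X -> R) : injective g -> finite_set [set x | w x != 0] ->
  finite_set [set x | (w \o g) x != 0].
Proof.
move=> gI fin; apply: (@finite_preimage _ _ [set x | w x != 0] g) => //.
exact: in2W.
Qed.

(** Substituting g x for x turns f f^T into Q_g f f^T Q_g^T and leaves the intensity unchanged. *)
Lemma information_comp (R : realType) (X : choiceType) (p : nat)
    (f : X -> 'cV[R]_p) (lam : R -> R) (w : X -> R) (b : 'cV[R]_p)
    (g : X -> X) (Qg : 'M[R]_p) :
  bijective g -> finite_set [set x | w x != 0] ->
  (forall x, f (g x) = Qg *m f x) ->
  (forall x, linpred f (g x) b = linpred f x b) ->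
  information f lam w b = Qg *m information f lam (w \o g) b *m Qg^T.
Proof.
move=> gbij fin fg lg.
have finC := finite_support_comp (bij_inj gbij) fin.
rewrite {1}/information (reindex_fsbigT g) // information_finE //.
(* The factors are distributed over a finite sum, which is then turned back into a sum over all of
   [X] for a termwise comparison. *)
rewrite mulmx_sumr mulmx_suml -(@fsbig_finite_support _ _ _ (fun x =>
  Qg *m ((w (g x) * lam (linpred f x b)) *: (f x *m (f x)^T)) *m Qg^T)) //.
  apply: eq_fsbigr => x _.
  by rewrite lg fg trmx_mul -scalemxAr -scalemxAl !mulmxA.
move=> x /= /negP; rewrite negbK => /eqP ->.
by rewrite mul0r scale0r mulmx0 mul0mx.
Qed.

Lemma quad_outer (R : comPzRingType) (n : nat) (v u : 'cV[R]_n) :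
  (u^T *m (v *m v^T) *m u) 0 0 = (v^T *m u) 0 0 ^+ 2.
Proof.
rewrite !mulmxA -(mulmxA (u^T *m v)) [LHS]mxE big_ord1 expr2; congr (_ * _).
by rewrite -[v in LHS]trmxK -trmx_mul mxE.
Qed.

Lemma quad_information (R : realType) (X : choiceType) (p : nat)
    (f : X -> 'cV[R]_p) (lam : R -> R) (w : X -> R) (b u : 'cV[R]_p) :
  finite_set [set x | w x != 0] ->
  (u^T *m information f lam w b *m u) 0 0 =
  \sum_(x <- fset_set [set x | w x != 0])
    w x * lam (linpred f x b) * linpred f x u ^+ 2.
Proof.
move=> fin; rewrite information_finE // mulmx_sumr mulmx_suml summxE.
by apply: eq_bigr => x _; rewrite -scalemxAr -scalemxAl mxE quad_outer.
Qed.

Lemma information_sym (R : realType) (X : choiceType) (p : nat)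
    (f : X -> 'cV[R]_p) (lam : R -> R) (w : X -> R) (b : 'cV[R]_p) :
  finite_set [set x | w x != 0] ->
  (information f lam w b)^T = information f lam w b.
Proof.
move=> fin; rewrite information_finE // linear_sum /=; apply: eq_bigr => x _.
by rewrite linearZ /= trmx_mul trmxK.
Qed.

Lemma information_psd (R : realType) (X : choiceType) (p : nat)
    (f : X -> 'cV[R]_p) (lam : R -> R) (w : X -> R) (b u : 'cV[R]_p) :
  finite_set [set x | w x != 0] -> (forall x, 0 <= w x) ->
  (forall x, 0 <= lam (linpred f x b)) ->
  0 <= (u^T *m information f lam w b *m u) 0 0.
Proof.
move=> fin w0 l0; rewrite quad_information //; apply: sumr_ge0 => x _.
by rewrite mulr_ge0 ?sqr_ge0 // mulr_ge0.
Qed.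

(** If the form vanishes at u, so does each of its nonnegative terms; then every summand of M kills
    u, and M u = 0 forces u = 0. *)
Lemma information_posdef (R : realType) (X : choiceType) (p : nat)
    (f : X -> 'cV[R]_p) (lam : R -> R) (w : X -> R) (b : 'cV[R]_p) :
  finite_set [set x | w x != 0] -> (forall x, 0 <= w x) ->
  (forall x, 0 <= lam (linpred f x b)) ->
  information f lam w b \in unitmx -> posdef (information f lam w b).
Proof.
move=> fin w0 l0 Mu; split; first exact: information_sym.
move=> u u0; rewrite lt_def information_psd // andbT.
apply: contra_neq u0; rewrite quad_information // => /eqP.
rewrite psumr_eq0 => [/allP/= h|x _]; last first.
  by rewrite mulr_ge0 ?sqr_ge0 // mulr_ge0.
suff Mu0 : information f lam w b *m u = 0 by rewrite -(mulKmx Mu u) Mu0 mulmx0.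
rewrite information_finE // mulmx_suml big1_seq // => x /andP[_ /h].
rewrite mulf_eq0 => /orP[/eqP->|]; first by rewrite scale0r mul0mx.
rewrite sqrf_eq0 => /eqP fu0; rewrite -scalemxAl -mulmxA [_ *m u]mx11_scalar.
by rewrite -/(linpred f x u) fu0 (_ : 0%:M = 0) ?mulmx0 ?scaler0 // raddf0.
Qed.

(** * Averaging a design over a finite list of transformations *)

(* [w \o g] is the image of the design [w] under the inverse of [g]. *)
Definition design_avg (R : realType) (X : choiceType) (s : seq (X -> X))
    (w : X -> R) : X -> R :=
  fun x => (size s)%:R^-1 * \sum_(g <- s) w (g x).

(** Union of the supports of all [w \o g]: a common index set for these functions and their
    average. *)
Definition orbit_support (R : realType) (X : choiceType) (s : seq (X -> X))
    (w : X -> R) : set X :=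
  \bigcup_(g in [set` s]) [set x | (w \o g) x != 0].

Lemma finite_orbit_support (R : realType) (X : choiceType) (s : seq (X -> X))
    (w : X -> R) : (forall g, g \in s -> injective g) ->
  finite_set [set x | w x != 0] -> finite_set (orbit_support s w).
Proof.
move=> sI fin; apply: bigcup_finite => // g gs.
by apply: finite_support_comp => //; apply: sI.
Qed.

Lemma orbit_support_comp (R : realType) (X : choiceType) (s : seq (X -> X))
    (w : X -> R) (g : X -> X) (x : X) : g \in s ->
  ~ orbit_support s w x -> w (g x) = 0.
Proof.
by move=> gs nx; apply/eqP/negPn/negP => wgx; apply: nx; exists g.
Qed.

Lemma orbit_support_avg (R : realType) (X : choiceType) (s : seq (X -> X))
    (w : X -> R) (x : X) : ~ orbit_support s w x -> design_avg s w x = 0.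
Proof.
move=> nx; rewrite /design_avg big1_seq ?mulr0 // => g /andP[_ gs].
exact: orbit_support_comp nx.
Qed.

Lemma information_avg (R : realType) (X : choiceType) (p : nat)
    (f : X -> 'cV[R]_p) (lam : R -> R) (w : X -> R) (b : 'cV[R]_p)
    (s : seq (X -> X)) : (forall g, g \in s -> injective g) ->
  finite_set [set x | w x != 0] ->
  information f lam (design_avg s w) b =
  (size s)%:R^-1 *: \sum_(g <- s) information f lam (w \o g) b.
Proof.
move=> sI fin; have Sfin := finite_orbit_support sI fin.
rewrite (information_finite_support _ _ _ Sfin (@orbit_support_avg _ _ s w)).
under [in RHS]eq_big_seq => g gs.
  rewrite (information_finite_support _ _ _ Sfin
    (fun x => orbit_support_comp gs (x:=x))).
  over.
rewrite exchange_big scaler_sumr /=; apply: eq_bigr => x _.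
rewrite /design_avg -mulrA -scalerA mulr_suml scaler_suml.
by congr (_ *: _); apply: eq_bigr.
Qed.

Lemma design_avg_is_design (R : realType) (X : choiceType) (s : seq (X -> X))
    (w : X -> R) : (forall g, g \in s -> bijective g) -> s != [::] ->
  is_design w -> is_design (design_avg s w).
Proof.
move=> sB s0 [w0 fin w1].
have Sfin := finite_orbit_support (fun g gs => bij_inj (sB g gs)) fin.
split.
- by move=> x; rewrite mulr_ge0 ?invr_ge0 ?ler0n // sumr_ge0.
- apply: sub_finite_set Sfin => x /= /eqP avg0.
  by apply: contrapT => nx; apply: avg0; apply: orbit_support_avg.
rewrite (fsbig_finite_support Sfin (@orbit_support_avg _ _ s w)).
rewrite /design_avg -mulr_sumr exchange_big /=.
(* Each inner sum is the total weight of [w], reindexed along the bijection g. *)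
rewrite (eq_big_seq (fun=> 1)); last first.
  move=> g gs; rewrite -(fsbig_finite_support Sfin).
    by rewrite -(reindex_fsbigT g w (sB g gs)).
  by move=> x; apply: orbit_support_comp.
rewrite big_const_seq count_predT iter_addr_0 mulVf //.
by rewrite pnatr_eq0 size_eq0.
Qed.

(** An injective self-map of a finite set is onto; this is applied to the translations of the
    group. *)
Lemma perm_eq_map_inj (T : eqType) (s : seq T) (phi : T -> T) :
  uniq s -> {in s &, injective phi} -> (forall x, x \in s -> phi x \in s) ->
  perm_eq (map phi s) s.
Proof.
move=> us phiI phis; have um : uniq (map phi s) by rewrite map_inj_in_uniq.
have sub : {subset map phi s <= s} by move=> _ /mapP[x xs ->]; apply: phis.
by apply: uniq_perm => //; apply: (uniq_min_size um sub _).2; rewrite size_map.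
Qed.

(** * Integrals under an invariant measure and the matrix V *)

Lemma integral_measure_preserving (R : realType) (d : measure_display)
    (X : measurableType d) (nu : probability X R) (g : X -> X) (h : X -> R) :
  measurable_fun [set: X] g ->
  (forall A, measurable A -> pushforward nu g A = nu A) ->
  nu.-integrable [set: X] (EFin \o h) ->
  nu.-integrable [set: X] (EFin \o (h \o g)) ->
  Rintegral nu [set: X] (h \o g) = Rintegral nu [set: X] h.
Proof.
move=> mg gnu ih ihg; rewrite /Rintegral; congr fine.
have <- : (\int[pushforward nu g]_x (h x)%:E = \int[nu]_x (h x)%:E)%E.
  by apply: eq_measure_integral => // A mA _; apply: gnu.
rewrite (@integral_pushforward _ _ _ _ _ _ mg _ setT (EFin \o h)) //.
exact: measurable_int ih.
Qed.

(** Integrability and value are proved together, since additivity in the induction step requires the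
    tail to be integrable. *)
Lemma Rintegral_lincomb (R : realType) (d : measure_display)
    (X : measurableType d) (nu : probability X R) (I : Type) (s : seq I)
    (c : I -> R) (h : I -> X -> R) :
  (forall i, nu.-integrable [set: X] (EFin \o h i)) ->
  nu.-integrable [set: X] (EFin \o fun x => \sum_(i <- s) c i * h i x) /\
  Rintegral nu [set: X] (fun x => \sum_(i <- s) c i * h i x) =
  \sum_(i <- s) c i * Rintegral nu [set: X] (h i).
Proof.
move=> ih.
have ich i : nu.-integrable [set: X] (EFin \o (fun x => c i * h i x)).
  apply: (eq_integrable _ (fun x => (c i)%:E * (h i x)%:E)%E) => //.
  by apply: integrableZl => //; apply: ih.
elim: s => [|j s [iI IH]].
  split; first by under [X in EFin \o X]eq_fun do rewrite big_nil;
    exact: integrable0.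
  by under [X in Rintegral _ _ X]eq_fun do rewrite big_nil;
    rewrite big_nil Rintegral_cst // mul0r.
have E x : \sum_(k <- j :: s) c k * h k x =
  c j * h j x + \sum_(k <- s) c k * h k x by rewrite big_cons.
under [X in EFin \o X]eq_fun do rewrite E.
under [X in Rintegral _ _ X]eq_fun do rewrite E.
split; last by rewrite RintegralD // IH RintegralZl // big_cons.
have iD := integrableD measurableT (ich j) iI.
by apply: eq_integrable iD => //.
Qed.

(** Exhibits an entry of A H B as one linear combination of the entries of H, the shape that
    [Rintegral_lincomb] handles. *)
Lemma mulmx_pair (R : comPzRingType) (m n p q : nat) (A : 'M[R]_(m, n))
    (H : 'M[R]_(n, p)) (B : 'M[R]_(p, q)) (i : 'I_m) (j : 'I_q) :
  (A *m H *m B) i j =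
  \sum_(k : 'I_n * 'I_p) A i k.1 * B k.2 j * H k.1 k.2.
Proof.
rewrite -(pair_big xpredT xpredT (fun k l => A i k * B l j * H k l)) /=.
rewrite exchange_big mxE; apply: eq_bigr => l _; rewrite mxE mulr_suml.
by apply: eq_bigr => k _; rewrite mulrAC.
Qed.

(** Rectangular [A] and [B] cover both uses: u^T V u for semidefiniteness and Q_g V Q_g^T for
    invariance. *)
Lemma V_matrix_congr (R : realType) (d : measure_display)
    (X : measurableType d) (p m q : nat) (f : X -> 'cV[R]_p) (lam : R -> R)
    (b : 'cV[R]_p) (nu : probability X R) (A : 'M[R]_(m, p)) (B : 'M[R]_(p, q))
    (i : 'I_m) (j : 'I_q) : V_integrable f lam b nu ->
  nu.-integrable [set: X]
    (EFin \o fun x => (A *m V_integrand f lam b x *m B) i j) /\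
  Rintegral nu [set: X] (fun x => (A *m V_integrand f lam b x *m B) i j) =
  (A *m V_matrix f lam b nu *m B) i j.
Proof.
move=> iV; have E x := mulmx_pair A (V_integrand f lam b x) B i j.
under [X in EFin \o X]eq_fun do rewrite E.
under [X in Rintegral _ _ X]eq_fun do rewrite E.
have [i1 ->] := Rintegral_lincomb (index_enum _) (fun k => A i k.1 * B k.2 j)
  (fun k : 'I_p * 'I_p => iV k.1 k.2).
by split => //; rewrite mulmx_pair; apply: eq_bigr => k _; rewrite mxE.
Qed.

Lemma V_matrix_psd (R : realType) (d : measure_display)
    (X : measurableType d) (p : nat) (f : X -> 'cV[R]_p) (lam : R -> R)
    (b : 'cV[R]_p) (nu : probability X R) (u : 'cV[R]_p) :
  V_integrable f lam b nu -> 0 <= (u^T *m V_matrix f lam b nu *m u) 0 0.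
Proof.
move=> iV; have [_ <-] := V_matrix_congr u^T u 0 0 iV.
apply: Rintegral_ge0 => x _; rewrite -scalemxAr -scalemxAl mxE quad_outer.
by rewrite mulr_ge0 ?sqr_ge0.
Qed.

(** Congruence by Q_g turns the integrand at x into the integrand at g x, and [nu] is preserved by
    g. *)
Lemma V_matrix_invariant (R : realType) (d : measure_display)
    (X : measurableType d) (p : nat) (f : X -> 'cV[R]_p) (lam : R -> R)
    (b : 'cV[R]_p) (nu : probability X R) (g : X -> X) (Qg : 'M[R]_p) :
  V_integrable f lam b nu -> measurable_fun [set: X] g ->
  (forall A, measurable A -> pushforward nu g A = nu A) ->
  (forall x, f (g x) = Qg *m f x) ->
  (forall x, linpred f (g x) b = linpred f x b) ->
  Qg *m V_matrix f lam b nu *m Qg^T = V_matrix f lam b nu.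
Proof.
move=> iV mg gnu fg lg; apply/matrixP => i j.
have [iQ <-] := V_matrix_congr Qg Qg^T i j iV.
have E x : (Qg *m V_integrand f lam b x *m Qg^T) i j =
    V_integrand f lam b (g x) i j.
  by rewrite /V_integrand lg fg trmx_mul -scalemxAr -scalemxAl !mulmxA.
move: iQ; under [X in EFin \o X]eq_fun do rewrite E; move=> iQ.
under [X in Rintegral _ _ X]eq_fun do rewrite E.
by rewrite mxE -(integral_measure_preserving mg gnu (iV i j) iQ).
Qed.

(** * Group translations, the linear predictor on orbits, and invariance of the average *)

(** Left translations serve to reindex orbit sums of the linear predictor, right translations to
    reindex the average of a design. *)
Lemma transformation_group_enum (X : choiceType) (G : set (X -> X)) :
  transformation_group G -> finite_set G ->
  exists s : seq (X -> X), [/\ uniq s, forall g, G g <-> g \in s,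
    forall h, G h -> perm_eq [seq h \o g | g <- s] s &
    forall h, G h -> perm_eq [seq g \o h | g <- s] s].
Proof.
move=> [_ _ Gcomp Ginv] /finite_seqP[s0 GE].
have Gs g : G g <-> g \in undup s0 by rewrite GE mem_undup.
exists (undup s0); split; rewrite ?undup_uniq // => h Gh;
  have [k [_ hk kh]] := Ginv h Gh;
  (apply: perm_eq_map_inj; first exact: undup_uniq).
- move=> g1 g2 _ _ e; apply/funext => x.
  exact: (can_inj hk) (congr1 (fun F => F x) e).
- by move=> g /Gs Gg; apply/Gs/Gcomp.
- move=> g1 g2 _ _ e; apply/funext => x.
  by have := congr1 (fun F => F (k x)) e; rewrite /= kh.
- by move=> g /Gs Gg; apply/Gs/Gcomp.
Qed.

(* In the extended case the scalar c g b equals 1, since it leaves the positive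
   sum of the linear predictor over a G-orbit unchanged. *)
Lemma linpred_invariant (R : realType) (X : choiceType)
    (p : nat) (f : X -> 'cV[R]_p) (lam : R -> R) (B : set 'cV[R]_p)
    (G : set (X -> X)) (Q : (X -> X) -> 'M[R]_p)
    (gt : (X -> X) -> 'cV[R]_p -> 'cV[R]_p) (b : 'cV[R]_p) :
  transformation_group G -> finite_set G ->
  (forall g, G g -> Q g \in unitmx) ->
  (forall g, G g -> forall x, f (g x) = Q g *m f x) ->
  linear_transformations B G Q gt \/
    (gamma_inverse_link f lam B /\ extended_transformations B G Q gt) ->
  B b -> (forall g, G g -> gt g b = b) ->
  forall g, G g -> forall x, linpred f (g x) b = linpred f x b.
Proof.
move=> Ggrp Gfin Qu fE kind Bb bfix g Gg x.
have QTu : (Q g)^T \in unitmx by rewrite unitmx_tr Qu.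
have lE y : linpred f (g y) b = ((f y)^T *m ((Q g)^T *m b)) 0 0.
  by rewrite /linpred fE // trmx_mul mulmxA.
case: kind => [lin|[[_ lpos] [[c cE] _]]].
  by rewrite lE -{1}(bfix g Gg) lin // mulKVmx.
have [cpos gtE] := cE g Gg b Bb.
(* The fixed point equation reads Q_g^T b = c b, so g scales every linear predictor by the same
   c. *)
have lc y : linpred f (g y) b = c g b * linpred f y b.
  by rewrite lE -{1}(bfix g Gg) gtE -scalemxAr mulKVmx // -scalemxAr mxE.
have [s [us sG permL _]] := transformation_group_enum Ggrp Gfin.
pose S := \sum_(h <- s) linpred f (h x) b.
have S0 : 0 < S.
  have ids : id \in s by apply/sG; case: Ggrp.
  rewrite /S (bigD1_seq _ ids us) /=; apply: ltr_pwDl; first exact: lpos.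
  by apply: sumr_ge0 => h _; apply: ltW; apply: lpos.
(* Left translation by g permutes the terms of S; as S > 0, this leaves only c = 1. *)
have cS : c g b * S = S.
  rewrite /S -[RHS](perm_big _ (permL g Gg)) big_map mulr_sumr.
  by apply: eq_bigr => h _; rewrite /= lc.
by rewrite lc (mulIf (lt0r_neq0 S0) (etrans cS (esym (mul1r S)))) mul1r.
Qed.

(** Writing y = g (k y), the claim becomes equality of the average at k y and at g (k y), which is
    right translation by g. *)
Lemma design_avg_invariant (R : realType) (X : choiceType) (G : set (X -> X))
    (s : seq (X -> X)) (w : X -> R) : (forall g, G g -> bijective g) ->
  (forall h, G h -> perm_eq [seq g \o h | g <- s] s) ->
  design_invariant G (design_avg s w).
Proof.
move=> Gbij permR g Gg; have [k gk kg] := Gbij g Gg.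
apply/funext => y; rewrite -[y]kg design_imageE; last exact: can_inj gk.
by rewrite /design_avg -[in LHS](perm_big _ (permR g Gg)) big_map.
Qed.

(** * Comparison of a design of nonsingular information matrix with its group average *)

Section InvariantDesign.
Variables (R : realType) (X : choiceType) (p : nat) (f : X -> 'cV[R]_p).
Variables (lam : R -> R) (b : 'cV[R]_p) (G : set (X -> X)).
Variables (Q : (X -> X) -> 'M[R]_p) (s : seq (X -> X)) (w : X -> R).
Hypothesis Gbij : forall g, G g -> bijective g.
Hypothesis Gid : G id.
Hypothesis us : uniq s.
Hypothesis sG : forall g, G g <-> g \in s.
Hypothesis permR : forall h, G h -> perm_eq [seq g \o h | g <- s] s.
Hypothesis Qu : forall g, G g -> Q g \in unitmx.
Hypothesis fE : forall g, G g -> forall x, f (g x) = Q g *m f x.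
Hypothesis lE : forall g, G g -> forall x, linpred f (g x) b = linpred f x b.
Hypothesis lam_ge0 : forall x, 0 <= lam (linpred f x b).
Hypothesis w_design : is_design w.
Hypothesis Mu : information f lam w b \in unitmx.

Let M := information f lam w b.
Let S := information f lam (design_avg s w) b.

Lemma orbit_size_neq0 : (size s)%:R != 0 :> R.
Proof. by rewrite pnatr_eq0; have /sG := Gid; case: s. Qed.

Lemma avg_is_design : is_design (design_avg s w).
Proof.
apply: design_avg_is_design => // [g /sG|]; first exact: Gbij.
by have /sG := Gid; case: s.
Qed.

Lemma information_avgE :
  S = (size s)%:R^-1 *: \sum_(g <- s) information f lam (w \o g) b.
Proof.
case: w_design => _ fin _; apply: information_avg => // g /sG Gg.
exact/bij_inj/Gbij.
Qed.

(** The term of [id] is M itself, which is positive definite; semidefiniteness of the other terms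
    suffices. *)
Lemma information_avg_posdef : posdef S.
Proof.
have [wge0 fin _] := w_design; have [avg0 avgfin _] := avg_is_design.
split; first exact: information_sym.
move=> u u0; rewrite information_avgE -scalemxAr -scalemxAl mxE.
apply: mulr_gt0; first by rewrite invr_gt0 lt_def orbit_size_neq0 ler0n.
rewrite mulmx_sumr mulmx_suml summxE (bigD1_seq _ ((sG _).1 Gid) us) /=.
apply: ltr_pwDl.
  by have [_] := information_posdef fin wge0 lam_ge0 Mu; apply.
rewrite big_seq_cond; apply: sumr_ge0 => g /andP[/sG Gg _].
apply: information_psd => // [|x]; last exact: wge0.
by apply: finite_support_comp => //; apply/bij_inj/Gbij.
Qed.

Lemma information_avg_congr g : G g -> S = Q g *m S *m (Q g)^T.
Proof.
move=> Gg; have [_ avgfin _] := avg_is_design.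
(* It remains to see that composing the average with g does not change it. *)
rewrite {1}/S (information_comp lam (Gbij Gg) avgfin (fE Gg) (lE Gg)).
congr (_ *m information f lam _ b *m _).
apply/funext => x; rewrite /design_avg /=.
by rewrite -[in RHS](perm_big _ (permR Gg)) big_map.
Qed.

Lemma inv_information_avg_congr g :
  G g -> (Q g)^T *m invmx S *m Q g = invmx S.
Proof.
move=> Gg; have Su := posdef_unitmx information_avg_posdef.
have Qgu := Qu Gg; have QTu : (Q g)^T \in unitmx by rewrite unitmx_tr.
(* Multiplying on the right by S and then by Q_g^T makes Q_g S Q_g^T appear, which equals S. *)
apply: (can_inj (mulmxK Su)); rewrite mulVmx //.
apply: (can_inj (mulmxK QTu)); rewrite mul1mx -!mulmxA (mulmxA (Q g)).
by rewrite -(information_avg_congr Gg) mulVmx // mulmx1.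
Qed.

(** Let M_g be the matrix of [w \o g]. Then M = Q_g M_g Q_g^T, and by cyclicity tr (W M) = tr (Q_g^T
    W Q_g M_g) = tr (W M_g), so all terms of the average agree. *)
Lemma trace_information_avg (W : 'M[R]_p) :
  (forall g, G g -> (Q g)^T *m W *m Q g = W) -> \tr (W *m S) = \tr (W *m M).
Proof.
move=> WQ; have [_ fin _] := w_design.
rewrite information_avgE -scalemxAr mxtraceZ mulmx_sumr raddf_sum /=.
rewrite (eq_big_seq (fun=> \tr (W *m M))) => [|g /sG Gg].
  rewrite big_const_seq count_predT iter_addr_0 -(mulr_natl (\tr _)) mulrA.
  by rewrite mulVf ?orbit_size_neq0 // mul1r.
rewrite /M (information_comp lam (Gbij Gg) fin (fE Gg) (lE Gg)) -{1}(WQ g Gg).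
by rewrite -!mulmxA mxtrace_mulC -!mulmxA.
Qed.

Lemma det_information_avg : \det M <= \det S.
Proof.
have [wge0 fin _] := w_design.
apply: det_le_of_trace; first exact: information_avg_posdef.
  exact: information_posdef.
rewrite -(trace_information_avg (W := invmx S)); last first.
  exact: inv_information_avg_congr.
by rewrite mulVmx ?mxtrace1 //; apply/posdef_unitmx/information_avg_posdef.
Qed.

Lemma trace_inv_information_avg (V : 'M[R]_p) :
  (forall u : 'cV_p, 0 <= (u^T *m V *m u) 0 0) ->
  (forall g, G g -> Q g *m V *m (Q g)^T = V) ->
  \tr (V *m invmx S) <= \tr (V *m invmx M).
Proof.
move=> psdV VQ; have [wge0 fin _] := w_design.
have pdS := information_avg_posdef.
apply: trace_inv_le => //; first exact: information_posdef.
rewrite -(trace_information_avg (W := invmx S *m V *m invmx S)).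
  by rewrite mulmxKV ?posdef_unitmx // mxtrace_mulC.
(* Replacing V by Q_g V Q_g^T groups the product as T V T, where T = Q_g^T S^-1 Q_g = S^-1. *)
move=> g Gg; rewrite -[in LHS](VQ g Gg).
set T := (Q g)^T *m invmx S *m Q g; rewrite -[RHS](_ : T *m V *m T = _).
  by rewrite /T !mulmxA.
by rewrite /T inv_information_avg_congr.
Qed.

End InvariantDesign.

(** * Invariant D-optimal and IMSE-optimal designs obtained from optimal ones *)

Theorem corollary7 (R : realType) (d : measure_display) (X : measurableType d)
    (p : nat) (f : X -> 'cV[R]_p) (lam : R -> R) (B : set 'cV[R]_p)
    (G : set (X -> X)) (Q : (X -> X) -> 'M[R]_p)
    (gt : (X -> X) -> 'cV[R]_p -> 'cV[R]_p) (b : 'cV[R]_p)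
    (f_indep : regression_independent f)
    (lam_pos : forall x b', B b' -> 0 < lam (linpred f x b'))
    (G_group : transformation_group G)
    (G_finite : finite_set G)
    (Q_unit : forall g, G g -> Q g \in unitmx)
    (f_equiv : forall g, G g -> forall x, f (g x) = Q g *m f x)
    (gt_onto : forall g, G g -> gt g @` B = B)
    (gt_kind : linear_transformations B G Q gt \/
               (gamma_inverse_link f lam B /\
                extended_transformations B G Q gt))
    (Bb : B b)
    (b_fixed : forall g, G g -> gt g b = b) :
  ((exists w, locally_D_optimal f lam b w) ->
   exists w, locally_D_optimal f lam b w /\ design_invariant G w)
  /\
  (forall nu : probability X R,
     V_integrable f lam b nu ->
     (forall g, G g -> measurable_fun [set: X] g) ->
     measure_invariant G nu ->
     (exists w, locally_IMSE_optimal f lam b nu w) ->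
     exists w, locally_IMSE_optimal f lam b nu w /\ design_invariant G w).
Proof.
have [Gbij Gid _ _] := G_group.
have [s [us sG _ permR]] := transformation_group_enum G_group G_finite.
have lE := linpred_invariant G_group G_finite Q_unit f_equiv gt_kind Bb b_fixed.
have l0 x : 0 <= lam (linpred f x b) by apply/ltW/lam_pos.
have avgI (w : X -> R) : design_invariant G (design_avg s w).
  by apply: design_avg_invariant.
split=> [[w [wd wopt]]|nu iV gmeas nuG [w [wd Mu wopt]]];
    exists (design_avg s w); (split; last exact: avgI).
  split; first exact: avg_is_design Gbij Gid sG wd.
  move=> v vd; apply: le_trans (wopt v vd).
  (* If M is singular the bound is +oo and holds trivially. If M is nonsingular then so is S, and
     inversion reverses det M <= det S. *)
  rewrite /D_criterion; case: ifP => Su; case: ifP => Mu; rewrite ?leey //.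
  - rewrite lee_fin !det_inv lef_pV2 ?posrE.
    + exact: (det_information_avg Gbij Gid us sG permR Q_unit f_equiv lE l0
        wd Mu).
    + exact/posdef_det_gt0/(information_avg_posdef Gbij Gid us sG l0 wd Mu).
    + by case: (wd) => w0 fin _; apply/posdef_det_gt0/information_posdef.
  - have pdS := information_avg_posdef Gbij Gid us sG l0 wd Mu.
    by rewrite (posdef_unitmx pdS) in Su.
split; first exact: avg_is_design Gbij Gid sG wd.
  exact/posdef_unitmx/(information_avg_posdef Gbij Gid us sG l0 wd Mu).
move=> v vd Mv; apply: le_trans (wopt v vd Mv).
apply: (trace_inv_information_avg Gbij Gid us sG permR Q_unit f_equiv lE l0
  wd Mu).
  by move=> u; apply: V_matrix_psd.
move=> g Gg.
exact: (V_matrix_invariant iV (gmeas g Gg) (nuG g Gg) (f_equiv g Gg) (lE g Gg)).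
Qed.
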